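(* Let $n\ge1$, $e\ge 0$ and $t>1$ be integers and $q=(2e+1)t$. Every ordered perfect code $C\in LPL^{\infty}(n,e,q)$ has a generator matrix which is an $(e,q)$-perfect matrix.
   Context: For $a\in\mathbb{Z}_q$ with representative $\tilde a\in\{0,\dots,q-1\}$ put $|a|_1=\min\{\tilde a,q-\tilde a\}$. The maximum metric on $\mathbb{Z}_q^n$ is $d(x,y)=\max_i|x_i-y_i|_1$, and $B(x,r)=\{y\in\mathbb{Z}_q^n: d(x,y)\le r\}$. $LPL^{\infty}(n,e,q)$ is the set of linear perfect codes with packing radius $e$, i.e. of subgroups $C$ of $(\mathbb{Z}_q^n,+)$ with $\#C>1$ such that $\mathbb{Z}_q^n$ is the disjoint union of the balls $B(c,e)$, $c\in C$. A generator matrix of a linear code $C\subseteq\mathbb{Z}_q^n$ is a matrix $M\in\mathcal{M}_n(\mathbb{Z})$ whose rows form a $\mathbb{Z}$-basis of $\Lambda_C=\pi^{-1}(C)$, where $\pi:\mathbb{Z}^n\to\mathbb{Z}_q^n$ is reduction modulo $q$. Sections: for $I\subseteq[n]=\{1,\dots,n\}$ let $H_I=\{x\in\mathbb{Z}_q^n:x_i=0\ \forall i\in I\}$, let $\pi_I:\mathbb{Z}_q^n\to\mathbb{Z}_q^n$ be the homomorphism that sets the coordinates in $I$ to $0$ and keeps the others, $B(H_I,e)=\bigcup_{h\in H_I}B(h,e)$, and $C\langle I\rangle=\pi_I(B(H_I,e)\cap C)$. Ordered codes: a code $D\subseteq\mathbb{Z}_q^n$ is of type $i$ if $D+(2e+1)e_i\subseteq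 D$ ($e_i$ the $i$-th canonical vector), and $\tau(D)=\max\{i: D\text{ is of type }i\}$. For $C\in LPL^{\infty}(n,e,q)$ define $\wp_1=\tau(C)$, $J_1=\{\wp_1\}$, $C_1=C\langle J_1\rangle$, and for $1\le i<n$, $\wp_{i+1}=\tau(C_i)$, $J_{i+1}=J_i\cup\{\wp_{i+1}\}$, $C_{i+1}=C\langle J_{i+1}\rangle$. (By the Minkowski–Hajós theorem these are well defined and $\wp(C)=(\wp_1,\dots,\wp_n)$ is a permutation of $[n]$.) $C$ is ordered if $\wp(C)=(n,n-1,\dots,2,1)$. Perfect matrices: $\nabla_n(a)$ denotes the set of upper triangular $n\times n$ integer matrices with all diagonal entries equal to $a$. A matrix $M\in\nabla_n(2e+1)$ is $(e,q)$-perfect if there exist $A\in\nabla_n(t)$ and $B\in\nabla_n(1)$ with $AM=qB$. *)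

(* Defs.v *)
From mathcomp Require Import all_boot all_order all_algebra.
Set Implicit Arguments.
Unset Strict Implicit.
Unset Printing Implicit Defensive.
Import GRing.Theory.
Local Open Scope ring_scope.

(* Words are row vectors over 'Z_q and codes are finite sets of words.  The
   type 'Z_q is the ring of integers modulo q only when 1 < q.  Coordinates are
   indexed by 'I_n, i.e. from 0 to n - 1 instead of from 1 to n. *)

Definition abs1 (q : nat) (a : 'Z_q) : nat := minn a (q - a)%N.

Definition dist_max (n q : nat) (x y : 'rV['Z_q]_n) : nat :=
  (\max_(i < n) abs1 (x 0 i - y 0 i)%R)%N.

Definition cball (n q : nat) (x : 'rV['Z_q]_n) (r : nat) : {set 'rV['Z_q]_n} :=
  [set y | (dist_max x y <= r)%N].

Definition set_ball (n q : nat) (S : {set 'rV['Z_q]_n}) (r : nat) :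
    {set 'rV['Z_q]_n} :=
  \bigcup_(h in S) cball h r.

Definition LPL (n e q : nat) (C : {set 'rV['Z_q]_n}) : Prop :=
  [/\ zmod_closed C,
      (1 < #|C|)%N,
      {in C &, forall c c', c != c' -> [disjoint cball c e & cball c' e]} &
      set_ball C e = [set: 'rV['Z_q]_n]].

Definition coord_subspace (n q : nat) (I : {set 'I_n}) : {set 'rV['Z_q]_n} :=
  [set x : 'rV['Z_q]_n | [forall i in I, x 0 i == 0]].

Definition coord_proj (n q : nat) (I : {set 'I_n}) (x : 'rV['Z_q]_n) :
    'rV['Z_q]_n :=
  \row_i (if i \in I then 0 else x 0 i).

Definition code_section (n e q : nat) (C : {set 'rV['Z_q]_n}) (I : {set 'I_n}) :
    {set 'rV['Z_q]_n} :=
  coord_proj I @: (set_ball (coord_subspace q I) e :&: C).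

Definition of_type (n e q : nat) (D : {set 'rV['Z_q]_n}) (i : 'I_n) : bool :=
  [forall x in D, x + delta_mx 0 i *+ (2 * e + 1) \in D].

(* The largest i such that D is of type i, or None if D is of no type. *)
Definition tau (n e q : nat) (D : {set 'rV['Z_q]_n}) : option 'I_n :=
  [pick i | of_type e D i & [forall j, of_type e D j ==> (j <= i)%N]].

(* The pair (J_i, C_i), starting from J_0 = set0 and C_0 = C.  If tau is
   undefined at some stage then J is left unchanged; such a code is not ordered
   in the sense of [ordered_code]. *)
Definition section_step (n e q : nat) (C : {set 'rV['Z_q]_n})
    (s : {set 'I_n} * {set 'rV['Z_q]_n}) : {set 'I_n} * {set 'rV['Z_q]_n} :=
  let J := if tau e s.2 is Some j then j |: s.1 else s.1 in
  (J, code_section e C J).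

Definition section_seq (n e q : nat) (C : {set 'rV['Z_q]_n}) (i : nat) :
    {set 'I_n} * {set 'rV['Z_q]_n} :=
  iter i (section_step e C) (set0, C).

(* [wp e C i] is the entry of rank i + 1 of the sequence of the code C. *)
Definition wp (n e q : nat) (C : {set 'rV['Z_q]_n}) (i : nat) : option 'I_n :=
  tau e (section_seq e C i).2.

(* [rev_ord] sends i to n - 1 - i, so this is the sequence (n, ..., 2, 1). *)
Definition ordered_code (n e q : nat) (C : {set 'rV['Z_q]_n}) : Prop :=
  forall i : 'I_n, wp e C i = Some (rev_ord i).

Definition code_lattice (n q : nat) (C : {set 'rV['Z_q]_n}) :
    pred 'rV[int]_n :=
  fun x => map_mx (fun z : int => z%:~R : 'Z_q) x \in C.

(* [u *m M] is the combination of the rows of M with coefficients u. *)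
Definition generator_mx (n q : nat) (C : {set 'rV['Z_q]_n}) (M : 'M[int]_n) :
    Prop :=
  (forall u : 'rV[int]_n, u *m M = 0 -> u = 0) /\
  (forall x : 'rV[int]_n,
     code_lattice C x <-> exists u : 'rV[int]_n, x = u *m M).

(* [is_trig_mx] means lower triangular, whence the transpose. *)
Definition nabla (n : nat) (a : int) (M : 'M[int]_n) : bool :=
  is_trig_mx M^T && [forall i, M i i == a].

(* Meant for q a multiple of 2e + 1; the quotient is then t = q / (2e + 1). *)
Definition perfect_mx (n e q : nat) (M : 'M[int]_n) : Prop :=
  nabla (2 * e + 1)%N%:Z M /\
  exists A B : 'M[int]_n,
    [/\ nabla (q %/ (2 * e + 1))%N%:Z A, nabla 1 B & A *m M = q%:Z *: B].

(* Main.v *)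
Require Import Defs.
From mathcomp Require Import all_boot all_order all_algebra.
From mathcomp Require Import zify.

(** The code being ordered says that, for each coordinate [k], the section of
    [C] at the coordinates after [k] is of type [k].  That section contains
    [0], hence also [2e + 1] times the [k]-th canonical vector, and lifting
    this word back to [C] yields a codeword with [2e + 1] in position [k] and
    zeros before it ([exists_pivot_codeword]).  The integer
    representatives of these [n] codewords are the rows of an upper triangular
    matrix [M] with diagonal [2e + 1].

    The rows of [M] span the lattice of [C].  Indeed, Euclidean division with
    balanced remainders, carried out from the first coordinate to the last,
    brings any lattice vector into the box [[-e, e]^n] by subtracting a
    combination of the rows ([triangular_reduction]).  The remainder represents
    a codeword of the ball of radius [e] around [0]; the packing property makes
    it the zero word, and since [e < q] the remainder itself is zero
    ([small_lattice_vector_eq0]).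

    Finally [q] times each canonical vector lies in the lattice, so that
    [A *m M = q I] for some integer matrix [A].  Forward substitution
    ([triangular_solution_vanishes], [triangular_solution_pivot]) shows that
    [A] is upper triangular with diagonal [q / (2e + 1)], and [B] can be taken
    to be the identity. *)

Set Implicit Arguments.
Unset Strict Implicit.
Unset Printing Implicit Defensive.
Import Order.TTheory GRing.Theory Num.Theory.
Local Open Scope ring_scope.

(** * Triangular integer matrices *)

Lemma nablaP (n : nat) (a : int) (M : 'M[int]_n) :
  reflect ((forall i j : 'I_n, (j < i)%N -> M i j = 0) /\
           (forall i, M i i = a))
          (nabla a M).
Proof.
apply: (iffP andP) => -[Mtrig Mdiag]; split.
- by move=> i j ltji; have /is_trig_mxP/(_ j i ltji) := Mtrig; rewrite mxE.
- by move=> i; apply/eqP; move/forallP: Mdiag.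
- by apply/is_trig_mxP => i j ltij; rewrite mxE Mtrig.
- by apply/forallP => i; rewrite Mdiag.
Qed.

Section Triangular.

Variables (n : nat) (d : int) (M : 'M[int]_n).
Hypothesis Md : nabla d M.

Lemma triangular_solution_pivot (u : 'rV[int]_n) (i : 'I_n) :
  (forall j : 'I_n, (j < i)%N -> u 0 j = 0) -> (u *m M) 0 i = u 0 i * d.
Proof.
have [Mtrig Mdiag] := nablaP _ _ Md.
move=> u0; rewrite mxE (bigD1 i) //= Mdiag big1 ?addr0 // => j neji.
have [ltji | ltij | /val_inj eqji] := ltngtP j i.
- by rewrite u0 // mul0r.
- by rewrite Mtrig // mulr0.
- by rewrite eqji eqxx in neji.
Qed.

Lemma triangular_solution_vanishes (u : 'rV[int]_n) (k : nat) :
    d != 0 -> (forall i : 'I_n, (i < k)%N -> (u *m M) 0 i = 0) ->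
  forall i : 'I_n, (i < k)%N -> u 0 i = 0.
Proof.
move=> d0 uM0 i; have [m] := ubnP (val i); elim: m i => // m IHm i ltim ltik.
have u0 (j : 'I_n) : (j < i)%N -> u 0 j = 0.
  by move=> ltji; apply: IHm; [apply: leq_trans ltji _ | apply: ltn_trans ltik].
move: (uM0 i ltik); rewrite triangular_solution_pivot // => /eqP.
by rewrite mulf_eq0 (negPf d0) orbF => /eqP.
Qed.

Lemma triangular_mulmx_inj (u : 'rV[int]_n) : d != 0 -> u *m M = 0 -> u = 0.
Proof.
move=> d0 uM0; apply/rowP => i; rewrite [RHS]mxE.
by apply: (triangular_solution_vanishes (k := n) d0) => // j _; rewrite uM0 mxE.
Qed.

End Triangular.

(** The quotient is that of [z + e], which shifts the remainders from [[0, 2e]]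
    to [[-e, e]]. *)
Lemma balanced_division (e : nat) (z : int) :
  exists c : int, (`|(z - c * (2 * e + 1)%N%:Z)%R| <= e)%N.
Proof.
have := divz_eq (z + e%:Z) (2 * e + 1)%N%:Z.
have := modz_ge0 (z + e%:Z) (_ : (2 * e + 1)%N%:Z != 0).
have := ltz_pmod (z + e%:Z) (_ : 0 < (2 * e + 1)%N%:Z).
set c := divz _ _; set r := modz _ _ => rlt rge zE; exists c.
have {rlt} := rlt ltac:(lia); have {rge} := rge ltac:(lia); move: zE.
by move: (c * _) => p; lia.
Qed.

(** Adding a multiple of row [k] of an upper triangular matrix leaves the
    coordinates before [k] alone, so the coordinates can be reduced in
    increasing order. *)
Lemma triangular_reduction (n e : nat) (M : 'M[int]_n) (x : 'rV[int]_n) :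
    nabla (2 * e + 1)%N%:Z M ->
  exists u : 'rV[int]_n, forall i, (`|((x - u *m M) 0 i)%R| <= e)%N.
Proof.
move=> /nablaP[Mtrig Mdiag].
suff /(_ n (leqnn n))[u uP] (k : nat) : (k <= n)%N ->
    exists u : 'rV[int]_n,
      forall i : 'I_n, (i < k)%N -> (`|((x - u *m M) 0 i)%R| <= e)%N.
  by exists u => i; apply: uP.
elim: k => [_|k IHk ltkn]; first by exists 0.
have [u uP] := IHk (ltnW ltkn); pose k' := Ordinal ltkn.
have [c cP] := balanced_division e ((x - u *m M) 0 k').
exists (u + c *: delta_mx 0 k') => i; rewrite ltnS leq_eqVlt.
have -> : (x - (u + c *: delta_mx 0 k') *m M) 0 i
          = (x - u *m M) 0 i - c * M k' i.
  by rewrite mulmxDl -scalemxAl -rowE opprD addrA !mxE.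
case/predU1P => [eqik | ltik].
  by have -> : i = k' by [apply: val_inj]; rewrite Mdiag.
by rewrite Mtrig // mulr0 subr0 uP.
Qed.

(** * The lattice of a code *)

Section Code.

Variables (n q : nat) (C : {set 'rV['Z_q]_n}).
Hypothesis q_gt1 : (1 < q)%N.

Let reduce (x : 'rV[int]_n) : 'rV['Z_q]_n := map_mx intr x.

Lemma abs1_intr (z : int) : (abs1 (z%:~R : 'Z_q) <= `|z|)%N.
Proof.
have abs1_nat (m : nat) : (abs1 (m%:R : 'Z_q) <= m)%N.
  by rewrite /abs1 val_Zp_nat // geq_min leq_mod.
have abs1N (a : 'Z_q) : (abs1 (- a) <= abs1 a)%N.
  have ltaq : (a < q)%N by rewrite -[X in (_ < X)%N](Zp_cast q_gt1) ltn_ord.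
  rewrite /abs1 /=; move: (nat_of_ord a) ltaq; rewrite Zp_cast // => m ltmq.
  have [->|m_gt0] := posnP m; first by rewrite subn0 modnn !min0n.
  by rewrite modn_small; lia.
case: z => m; first exact: abs1_nat.
by rewrite NegzE mulrNz abszN; apply: leq_trans (abs1N _) (abs1_nat _).
Qed.

Lemma intr_Zq_eq0 (z : int) : (`|z| < q)%N -> (z%:~R : 'Z_q) = 0 -> z = 0.
Proof.
move=> ltzq z0; have : (`|z|%N%:R : 'Z_q) = 0.
  case: (intP z) z0 => // m; rewrite mulrNz abszN => /eqP.
  by rewrite oppr_eq0 => /eqP.
move/(congr1 val); rewrite /= val_Zp_nat // modn_small // => /eqP.
by rewrite absz_eq0 => /eqP.
Qed.

Lemma code_lattice_closed : zmod_closed C -> zmod_closed (code_lattice C).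
Proof.
case=> C0 CB; split=> [|x y xC yC]; rewrite unfold_in /code_lattice.
  by rewrite map_mx0.
by rewrite map_mxB CB.
Qed.

(** Applied to the canonical vectors, this gives a factorization of [q I]
    through every generator matrix. *)
Lemma code_lattice_modulus (x : 'rV[int]_n) :
  zmod_closed C -> code_lattice C (q%:Z *: x).
Proof.
case=> C0 _; rewrite /code_lattice.
suff -> : map_mx (fun z : int => z%:~R : 'Z_q) (q%:Z *: x) = 0 by [].
by apply/rowP => i; rewrite !mxE intrM -[q%:~R]/(q%:R) pchar_Zp // mul0r.
Qed.

Lemma code_lattice_mulmx (M : 'M[int]_n) (u : 'rV[int]_n) :
  zmod_closed C -> (forall k, code_lattice C (row k M)) ->
  code_lattice C (u *m M).
Proof.
move=> /code_lattice_closed[L0 LB] LM.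
have LN x : code_lattice C x -> code_lattice C (- x).
  by move=> Lx; rewrite -sub0r; apply: LB.
have LD x y : code_lattice C x -> code_lattice C y -> code_lattice C (x + y).
  by move=> Lx Ly; rewrite -[y]opprK; apply: LB => //; apply: LN.
have LMn x m : code_lattice C x -> code_lattice C (x *+ m).
  by move=> Lx; elim: m => [|m IHm]; rewrite ?mulr0n // mulrS LD.
rewrite mulmx_sum_row; elim/big_ind: _ => // k _.
rewrite -[u 0 k]intz scaler_int.
by case: (u 0 k) => m; [apply: LMn | apply/LN/LMn].
Qed.

(** The balls around [0] and around a codeword of the ball of [0] both contain
    [0], so a packing leaves only the zero codeword. *)
Lemma small_lattice_vector_eq0 (e : nat) (x : 'rV[int]_n) :
    LPL e C -> (e < q)%N -> code_lattice C x ->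
  (forall i, (`|(x 0 i)%R| <= e)%N) -> x = 0.
Proof.
move=> [[C0 _] _ Cpack _] lteq Lx xle.
have x0 : reduce x = 0.
  apply/eqP/contraT => /(Cpack _ _ Lx C0)/pred0P/(_ 0); rewrite /= !inE.
  have -> : (dist_max 0 (0 : 'rV['Z_q]_n) <= e)%N.
    by apply/bigmax_leqP => i _; rewrite subrr /abs1 min0n.
  suff -> : (dist_max (reduce x) 0 <= e)%N by [].
  apply/bigmax_leqP => i _; rewrite !mxE subr0.
  exact: leq_trans (abs1_intr _) (xle i).
apply/rowP => i; rewrite [RHS]mxE; apply: intr_Zq_eq0.
  exact: leq_ltn_trans (xle i) lteq.
by have /rowP/(_ i) := x0; rewrite !mxE.
Qed.

End Code.

(** * Sections of an ordered code *)

Lemma zero_in_code_section (n e q : nat) (C : {set 'rV['Z_q]_n}) (I : {set 'I_n}) :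
  0 \in C -> 0 \in code_section e C I.
Proof.
move=> C0; apply/imsetP; exists 0; last by apply/rowP => i; rewrite !mxE if_same.
rewrite inE C0 andbT; apply/bigcupP; exists 0; rewrite inE.
  by apply/forall_inP => i _; rewrite mxE.
by apply/bigmax_leqP => i _; rewrite subrr /abs1 min0n.
Qed.

(** Step [k] adds the coordinate [n - 1 - k] to the set [J], which therefore
    stays a final segment.  The initial pair fits the same pattern as the
    sections do, because projecting along no coordinate is the identity. *)
Lemma section_seq_ordered (n e q : nat) (C : {set 'rV['Z_q]_n}) (k : nat) :
    0 \in C -> ordered_code e C -> (k <= n)%N ->
  let: (J, D) := section_seq e C k in
  [/\ J = [set j : 'I_n | (n - k <= j)%N], 0 \in D &
      forall y, y \in D -> exists2 c, c \in C & y = coord_proj J c].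
Proof.
move=> C0 Cord; elim: k => [_|k IHk ltkn] /=.
  split=> //; first by apply/setP => j; rewrite !inE subn0 leqNgt ltn_ord.
  by move=> y yC; exists y => //; apply/rowP => i; rewrite !mxE inE.
move: (Cord (Ordinal ltkn)) (IHk (ltnW ltkn)); rewrite /wp /=.
case: (section_seq e C k) => J D /= tauD [-> _ _]; rewrite tauD; split.
- apply/setP => j; rewrite !inE -val_eqE /=.
  by have := ltn_ord j; lia.
- exact: zero_in_code_section.
- by move=> y /imsetP[c]; rewrite inE => /andP[_ cC] ->; exists c.
Qed.

(** The section at the coordinates after [k] contains [0] and is of type [k],
    so it contains [2e + 1] times the [k]-th canonical vector; a codeword above
    it agrees with it up to coordinate [k]. *)
Lemma exists_pivot_codeword (n e q : nat) (C : {set 'rV['Z_q]_n}) (k : 'I_n) :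
    0 \in C -> ordered_code e C ->
  exists c, [/\ c \in C, forall j : 'I_n, (j < k)%N -> c 0 j = 0 &
                c 0 k = (2 * e + 1)%N%:R].
Proof.
move=> C0 Cord; pose i := rev_ord k.
have := section_seq_ordered C0 Cord (ltnW (ltn_ord i)).
have := Cord i; rewrite /wp rev_ordK.
case: (section_seq e C i) => J D /= tauD [J_def D0 Dlift].
have /forall_inP/(_ 0 D0) : of_type e D k.
  by move: tauD; rewrite /tau; case: pickP => // l /andP[Dl _] [<-].
rewrite add0r => /Dlift[c cC /rowP cE].
have c_out (j : 'I_n) : (j <= k)%N -> c 0 j = (2 * e + 1)%N%:R *+ (j == k).
  move=> lejk; have := cE j; rewrite mulmxnE !mxE /= J_def inE /=.
  have -> : (n - (n - k.+1) <= j)%N = false.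
    by have := ltn_ord k; lia.
  by move=> <-; rewrite -mulrnA mulnC mulrnA.
exists c; split=> // [j ltjk|]; last by rewrite c_out // eqxx.
by rewrite c_out ?(ltnW ltjk) // -val_eqE ltn_eqF.
Qed.

(** * The perfect generator matrix *)

Lemma exists_triangular_rows (n e q : nat) (C : {set 'rV['Z_q]_n}) :
    (2 * e + 1 < q)%N -> 0 \in C -> ordered_code e C ->
  exists M : 'M[int]_n,
    nabla (2 * e + 1)%N%:Z M /\ forall k, code_lattice C (row k M).
Proof.
move=> ltq C0 Cord.
have q_gt1 : (1 < q)%N by lia.
have [c cP] := fin_all_exists (fun k => exists_pivot_codeword k C0 Cord).
exists (\matrix_(k, j) (c k 0 j : nat)%:Z); split.
  apply/nablaP; split=> [k j ltjk | k]; rewrite mxE; have [_ c0 cd] := cP k.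
    by rewrite c0.
  by rewrite cd val_Zp_nat // modn_small.
move=> k; have [cC _ _] := cP k; rewrite /code_lattice.
rewrite (_ : map_mx _ _ = c k) //.
by apply/rowP => j; rewrite !mxE -pmulrn natr_Zp.
Qed.

(** Spanning is reduction into the box [[-e, e]^n], whose only lattice point is
    the origin. *)
Lemma triangular_generator_mx (n e q : nat) (C : {set 'rV['Z_q]_n}) (M : 'M[int]_n) :
    (2 * e + 1 < q)%N -> LPL e C -> nabla (2 * e + 1)%N%:Z M ->
    (forall k, code_lattice C (row k M)) ->
  generator_mx C M.
Proof.
move=> ltq CP Md LM; have [Czmod _ _ _] := CP.
split=> [u|x]; first by apply: (triangular_mulmx_inj Md); lia.
split=> [Lx | [u ->]]; last exact: code_lattice_mulmx.
have [u uP] := triangular_reduction x Md; exists u.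
apply/eqP; rewrite -subr_eq0; apply/eqP.
apply: (small_lattice_vector_eq0 _ CP _ _ uP); [lia | lia |].
have [_ LB] := code_lattice_closed Czmod.
by apply: LB => //; apply: code_lattice_mulmx.
Qed.

(** Row [i] of [A] solves a triangular system whose right-hand side vanishes
    before position [i] and equals [d * t] there. *)
Lemma triangular_cofactor (n d t : nat) (A M : 'M[int]_n) :
  (0 < d)%N -> nabla d%:Z M -> A *m M = (d * t)%N%:Z%:M -> nabla t%:Z A.
Proof.
move=> d_gt0 Md AM; have d0 : d%:Z != 0 by lia.
have AME i j : (row i A *m M) 0 j = (d * t)%N%:Z *+ (i == j).
  by rewrite -row_mul AM !mxE.
have Atrig (i j : 'I_n) : (j < i)%N -> A i j = 0.
  move=> ltji; have -> : A i j = row i A 0 j by rewrite mxE.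
  apply: (triangular_solution_vanishes Md d0 (k := i)) ltji => l ltli.
  by rewrite AME -val_eqE gtn_eqF.
apply/nablaP; split=> // i; apply: (mulIf d0).
have /esym := AME i i; rewrite (triangular_solution_pivot Md) => [|j ltji].
  by rewrite eqxx mxE => <-; rewrite mulnC PoszM.
by rewrite mxE Atrig.
Qed.

Local Close Scope ring_scope.

Theorem proposition5p13 (n e t q : nat) (hn : 0 < n) (ht : 1 < t)
    (hq : q = (2 * e + 1) * t) (C : {set 'rV['Z_q]_n})
    (hC : LPL e C) (hord : ordered_code e C) :
  exists M : 'M[int]_n, generator_mx C M /\ perfect_mx e q M.
Proof.
have [[C0 _] _ _ _] := hC.
have ltq : 2 * e + 1 < q by rewrite hq; nia.
have q_gt1 : 1 < q by lia.
have [M [Md LM]] := exists_triangular_rows ltq C0 hord.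
have Mgen := triangular_generator_mx ltq hC Md LM.
exists M; split=> //; split=> //.
have rowsA (k : 'I_n) : exists u : 'rV[int]_n, (q%:Z *: delta_mx 0 k = u *m M)%R.
  by apply: (Mgen.2 _).1; apply: code_lattice_modulus; have [] := hC.
have [A AP] := fin_all_exists rowsA.
have AM : ((\matrix_k A k) *m M = q%:Z%:M)%R.
  apply/row_matrixP => k.
  by rewrite row_mul rowK -AP -scalemx1 linearZ /= row1.
exists (\matrix_k A k)%R, 1%:M%R; split; last by rewrite scalemx1.
- apply: (triangular_cofactor (d := 2 * e + 1)) Md _; first by lia.
  by rewrite AM hq mulKn; last lia.
- by apply/nablaP; split=> [i j ltji | i]; rewrite mxE ?eqxx // -val_eqE gtn_eqF.
Qed.
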